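(* Let $\mathcal{A}$ be a small abelian length category and let $0=\mathcal{T}_0\lessdot\mathcal{T}_1\lessdot\cdots\lessdot\mathcal{T}_m=\mathcal{A}$ be a maximal green sequence in $\mathcal{A}$. Then there exists a sequence of bricks $N_1,N_2,\dots,N_m$ such that, with $N_0=0=N_{m+1}$: (i) $N_i$ is a minimal extending object of $\mathcal{T}_{i-1}$ and $\mathcal{T}_i=Filt(\mathcal{T}_{i-1}\cup\{N_i\})$ for each $1\le i\le m$. (ii) $\mathcal{T}_i=Filt(N_0,N_1,\dots,N_i)=\mathcal{G}(N_0\oplus N_1\oplus\cdots\oplus N_i)={}^{\perp}(N_{i+1}\oplus\cdots\oplus N_m\oplus N_{m+1})$ for each $0\le i\le m$. (iii) The sequence $N_1,N_2,\dots,N_m$ is a complete forward hom-orthogonal sequence in $\mathcal{A}$. (iv) $Filt(N_i)=\mathcal{T}_i\cap\mathcal{F}_{i-1}$ for each $1\le i\le m$, where $\mathcal{F}_{i-1}=\mathcal{T}_{i-1}^{\perp}$. (v) Up to isomorphism, each object $X$ in $\mathcal{A}$ admits a unique filtration $0=X_0\subset X_1\subset X_2\subset\cdots\subset X_m=X$ such that $X_i/X_{i-1}\in Filt(N_i)$ for each $1\le i\le m$.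
   Context: An abelian length category is an abelian category in which every object has finite length. For an object $N$, $N^{\perp}=\{X:\mathrm{Hom}(N,X)=0\}$ and ${}^{\perp}N=\{X:\mathrm{Hom}(X,N)=0\}$; for a subcategory $\mathcal{C}$, $\mathcal{C}^{\perp}=\{X:\mathrm{Hom}(Y,X)=0\ \forall Y\in\mathcal{C}\}$ and ${}^{\perp}\mathcal{C}=\{X:\mathrm{Hom}(X,Y)=0\ \forall Y\in\mathcal{C}\}$; $\mathcal{G}(N)={}^{\perp}(N^{\perp})$. A brick is an object whose endomorphism ring is a division ring. For a set (or class) $\mathcal{S}$ of objects, $Filt(\mathcal{S})$ is the full subcategory of objects having a finite filtration whose subquotients are isomorphic to indecomposable objects of $\mathcal{S}$; $Filt(N_0,\dots,N_i)=Filt(\{N_0,\dots,N_i\})$ and $Filt(N_i)=Filt(\{N_i\})$; the zero object lies in every $Filt$. A torsion class is a full subcategory closed under isomorphisms, extensions and factors. $\mathcal{T}\lessdot\mathcal{T}'$ means $\mathcal{T}\subsetneq\mathcal{T}'$ are torsion classes with no torsion class strictly between them. A maximal green sequence in $\mathcal{A}$ is a finite sequence of torsion classes $\mathcal{T}_0\lessdot\cdots\lessdot\mathcal{T}_m$ with $\mathcal{T}_0=0$ and $\mathcal{T}_m=\mathcal{A}$. An object $M$ is a minimal extending object for a torsion class $\mathcal{T}$ if (i) every proper factor of $M$ is in $\mathcal{T}$; (ii) if $0\to M\to X\to T\to0$ is a non-split exact sequence with $T\in\mathcal{T}$, then $X\in\mathcal{T}$; (iii) $\mathrm{Hom}(\mathcal{T},M)=0$.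 A complete forward hom-orthogonal sequence in $\mathcal{A}$ is a finite sequence of bricks $N_1,\dots,N_m$ such that (i) $\mathrm{Hom}(N_i,N_j)=0$ for all $1\le i<j\le m$; (ii) the sequence is maximal in $\mathcal{G}(N)$, where $N=N_1\oplus\cdots\oplus N_m$, meaning that no other bricks (of $\mathcal{G}(N)$) can be inserted into $N_1,\dots,N_m$ (at any position) preserving (i); (iii) $\mathcal{G}(N)=\mathcal{A}$. *)

(* Defs.v *)
From mathcomp Require Import all_boot all_algebra.
From mathcomp Require Import boolp classical_sets.

Set Implicit Arguments.
Unset Strict Implicit.
Unset Printing Implicit Defensive.

Import GRing.Theory.

Declare Scope cat_scope.
Delimit Scope cat_scope with cat.
Local Open Scope classical_set_scope.
Local Open Scope ring_scope.
Local Open Scope cat_scope.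

(* Objects and morphisms live in [Type], so the category is small.  Equality
   of morphisms is Leibniz equality; classically every abelian group carries
   the [choiceType] structure that [zmodType] asks for. *)
Record additiveCat := AdditiveCat {
  obj : Type;
  hom : obj -> obj -> zmodType;
  idm : forall X, hom X X;
  comp : forall X Y Z, hom Y Z -> hom X Y -> hom X Z;
  comp1m : forall X Y (f : hom X Y), comp (idm Y) f = f;
  compm1 : forall X Y (f : hom X Y), comp f (idm X) = f;
  compA : forall X Y Z W (h : hom Z W) (g : hom Y Z) (f : hom X Y),
    comp h (comp g f) = comp (comp h g) f;
  compDl : forall X Y Z (g g' : hom Y Z) (f : hom X Y),
    comp (g + g') f = comp g f + comp g' f;
  compDr : forall X Y Z (g : hom Y Z) (f f' : hom X Y),
    comp g (f + f') = comp g f + comp g f';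
  zob : obj;
  zob_initial : forall X (f : hom zob X), f = 0;
  zob_terminal : forall X (f : hom X zob), f = 0;
  oplus : obj -> obj -> obj;
  inj1 : forall X Y, hom X (oplus X Y);
  inj2 : forall X Y, hom Y (oplus X Y);
  prj1 : forall X Y, hom (oplus X Y) X;
  prj2 : forall X Y, hom (oplus X Y) Y;
  prj1_inj1 : forall X Y, comp (prj1 X Y) (inj1 X Y) = idm X;
  prj2_inj2 : forall X Y, comp (prj2 X Y) (inj2 X Y) = idm Y;
  prj1_inj2 : forall X Y, comp (prj1 X Y) (inj2 X Y) = 0;
  prj2_inj1 : forall X Y, comp (prj2 X Y) (inj1 X Y) = 0;
  oplus_id : forall X Y,
    comp (inj1 X Y) (prj1 X Y) + comp (inj2 X Y) (prj2 X Y) = idm (oplus X Y)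
}.

Arguments hom {a} X Y.
Arguments idm {a} X.
Arguments comp {a X Y Z} g f.
Arguments zob {a}.
Arguments oplus {a} X Y.

Notation "g \o f" := (comp g f) : cat_scope.

Section Morphisms.
Variable A : additiveCat.
Implicit Types X Y Z K Q : obj A.

Definition mono X Y (f : hom X Y) :=
  forall Z (g h : hom Z X), f \o g = f \o h -> g = h.

Definition epi X Y (f : hom X Y) :=
  forall Z (g h : hom Y Z), g \o f = h \o f -> g = h.

Definition is_iso X Y (f : hom X Y) :=
  exists g : hom Y X, g \o f = idm X /\ f \o g = idm Y.

Definition isomorphic X Y := exists f : hom X Y, is_iso f.

Definition is_kernel X Y (f : hom X Y) K (k : hom K X) :=
  f \o k = 0 /\
  forall Z (h : hom Z X), f \o h = 0 -> exists! l : hom Z K, k \o l = h.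

Definition is_cokernel X Y (f : hom X Y) Q (q : hom Y Q) :=
  q \o f = 0 /\
  forall Z (h : hom Y Z), h \o f = 0 -> exists! l : hom Q Z, l \o q = h.

(* Exactness of 0 -> X -> Y -> Z -> 0. *)
Definition short_exact X Y Z (f : hom X Y) (g : hom Y Z) :=
  is_kernel g f /\ is_cokernel f g.

Definition split_epi Y Z (g : hom Y Z) := exists s : hom Z Y, g \o s = idm Z.

End Morphisms.

Record abelianCat := AbelianCat {
  acat :> additiveCat;
  has_kernels : forall (X Y : obj acat) (f : hom X Y),
    exists K (k : hom K X), is_kernel f k;
  has_cokernels : forall (X Y : obj acat) (f : hom X Y),
    exists Q (q : hom Y Q), is_cokernel f q;
  mono_normal : forall (X Y : obj acat) (f : hom X Y), mono f ->
    exists Z (g : hom Y Z), is_kernel g f;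
  epi_normal : forall (X Y : obj acat) (f : hom X Y), epi f ->
    exists Z (g : hom Z X), is_cokernel g f
}.

Section Objects.
Variable A : abelianCat.
Implicit Types X Y Z N M B Q : obj A.
Implicit Types C S T : set (obj A).

Definition is_zero X := isomorphic X zob.

Definition simple X :=
  ~ is_zero X /\
  forall Y (f : hom Y X), mono f -> is_zero Y \/ is_iso f.

Definition indecomposable X :=
  ~ is_zero X /\
  forall Y Z, isomorphic X (oplus Y Z) -> is_zero Y \/ is_zero Z.

Definition brick X :=
  idm X <> 0 /\ forall f : hom X X, f <> 0 -> is_iso f.

Record subobj X := SubObj {
  sub_ob :> obj A;
  sub_mor : hom sub_ob X;
  sub_mono : mono sub_mor
}.

Definition sub_le X (U V : subobj X) :=
  exists v : hom U V, sub_mor V \o v = sub_mor U.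

(* U and V are isomorphic as subobjects of X, by an isomorphism compatible
   with the inclusions into X. *)
Definition sub_eq X (U V : subobj X) :=
  exists2 v : hom U V, is_iso v & sub_mor V \o v = sub_mor U.

(* U is contained in V, with V / U in C. *)
Definition subquotient_in C X (U V : subobj X) :=
  exists (v : hom U V) Q (q : hom V Q),
    [/\ sub_mor V \o v = sub_mor U, short_exact v q & C Q].

(* 0 = F 0 <= F 1 <= ... <= F n = X with F i.+1 / F i in C i for i < n.  The
   inclusions need not be strict, and the values F i for i > n are ignored. *)
Definition filtration (C : nat -> set (obj A)) n X (F : nat -> subobj X) :=
  [/\ is_zero (F 0%N), is_iso (sub_mor (F n)) &
      forall i, (i < n)%N -> subquotient_in (C i) (F i) (F i.+1)].

Definition finite_length X :=
  exists n (F : nat -> subobj X), filtration (fun=> simple) n F.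

Definition Filt S : set (obj A) :=
  [set X | exists n (F : nat -> subobj X),
     filtration
       (fun=> [set Q | exists Y, [/\ S Y, indecomposable Y & isomorphic Q Y]])
       n F].

Definition hom_zero X Y := forall f : hom X Y, f = 0.

Definition rperp C : set (obj A) :=
  [set X | forall Y, C Y -> hom_zero Y X].

Definition lperp C : set (obj A) :=
  [set X | forall Y, C Y -> hom_zero X Y].

Definition rperp_ob N : set (obj A) := [set X | hom_zero N X].

Definition lperp_ob N : set (obj A) := [set X | hom_zero X N].

Definition Gen_tors N : set (obj A) := lperp (rperp_ob N).

Definition torsion_class T :=
  [/\ forall X Y, isomorphic X Y -> T X -> T Y,
      forall X Y Z (f : hom X Y) (g : hom Y Z),
        short_exact f g -> T X -> T Z -> T Y &
      forall X Y (f : hom X Y), epi f -> T X -> T Y].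

Definition tors_cover T T' :=
  [/\ torsion_class T, torsion_class T', T `<` T' &
      forall T'', torsion_class T'' -> ~ (T `<` T'' /\ T'' `<` T')].

Definition maximal_green_sequence m (T : nat -> set (obj A)) :=
  [/\ forall i, (i <= m)%N -> torsion_class (T i),
      forall i, (i < m)%N -> tors_cover (T i) (T i.+1),
      T 0%N = [set X | is_zero X] &
      T m = setT].

Definition minimal_extending T M :=
  [/\ forall Q (q : hom M Q), epi q -> ~ is_iso q -> T Q,
      forall X Z (f : hom M X) (g : hom X Z),
        short_exact f g -> ~ split_epi g -> T Z -> T X &
      rperp T M].

Definition forward_hom_orthogonal (s : seq (obj A)) :=
  forall i j, (i < j < size s)%N -> hom_zero (nth zob s i) (nth zob s j).

Definition complete_forward_hom_orthogonal (s : seq (obj A)) :=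
  let N := \big[oplus/zob]_(X <- s) X in
  [/\ forall i, (i < size s)%N -> brick (nth zob s i),
      forward_hom_orthogonal s,
      forall s1 s2 B, s = s1 ++ s2 -> brick B -> Gen_tors N B ->
        ~ forward_hom_orthogonal (s1 ++ B :: s2) &
      Gen_tors N = setT].

End Objects.

Definition length_category (A : abelianCat) :=
  forall X : obj A, finite_length X.

(* Main.v *)
Require Import Defs.
From mathcomp Require Import all_boot all_algebra.
From mathcomp Require Import boolp classical_sets.

Set Implicit Arguments.
Unset Strict Implicit.
Unset Printing Implicit Defensive.

Local Open Scope classical_set_scope.

(** Everything rests on one observation about a cover T <. T' of torsion
    classes. Write F for the class T^perp. If L is a nonzero object of T'
    lying in F, then the objects X of T' with Hom(X, L) = 0 form a torsion
    class that contains T and misses L, so it is T itself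
    ([cover_left_orthogonal]). Hence there is a nonzero map between any two
    nonzero objects of T' lying in F.

    Choose M of minimal length in T' but not in T. Its proper quotients are in
    T by minimality, and M is in F: if M had a nonzero subobject I in T, then
    M / I would be in T as well, and so would the extension M. A nonzero map
    from M to an object of F is mono, because its image is a subobject of an
    object of F and would be in T if it were a proper quotient of M; so M is a
    brick. Suppose that X is an extension of an object of T by M and X is not
    in T. By the observation some map from X to M is nonzero, it is nonzero on
    M, so it is an automorphism there, and the extension splits. Thus M is
    minimal extending. Finally, every nonzero X in T' and F receives a
    nonzero, hence mono, map from M. The cokernel is again in F: a map to it
    from an object of T pulls the extension back, and the pullback splits or
    lies in T. By induction on the length, T' and F meet in Filt(M)
    ([cover_brick]).

    Let N_i be the brick obtained this way from the cover T_(i-1) <. T_i. The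
    torsion pair of T_(i-1) makes each object of T_i an extension of one of
    Filt(N_i) by one of T_(i-1), which by induction gives the descriptions of
    T_i by filtrations and by generation ([green_Filt], [green_Gen]). The
    observation with L = N_j, used for j = m, ..., i + 1, shows that T_i is
    the whole left orthogonal of the N_j with j > i ([green_lperp]). A brick
    inserted after N_i would then be in T_i and right orthogonal to T_i, which
    is absurd. The filtration of X consists of its torsion subobjects for the
    T_i; conversely, the i-th term of any filtration of this form is in T_i
    and contains the image of every map from an object of T_i to X, which
    determines it ([green_filtrationP]).

    The length of an object is the minimal number of simple steps in a
    filtration. It is superadditive on short exact sequences
    ([exists_length]), so it drops strictly for proper subobjects and proper
    quotients. *)

(** * Exactness in abelian categories *)

Section AbelianCategory.
Import GRing.Theory Defs.
Local Open Scope ring_scope.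
Local Open Scope cat_scope.
Variable A : abelianCat.
Implicit Types X Y Z W P U V Q S K : obj A.

Lemma comp0l X Y Z (f : hom X Y) : (0 : hom Y Z) \o f = 0.
Proof. by apply: (addrI (0 \o f)); rewrite -compDl !addr0. Qed.

Lemma comp0r X Y Z (g : hom Y Z) : g \o (0 : hom X Y) = 0.
Proof. by apply: (addrI (g \o 0)); rewrite -compDr !addr0. Qed.

Lemma compNl X Y Z (g : hom Y Z) (f : hom X Y) : (- g) \o f = - (g \o f).
Proof. by apply: (addrI (g \o f)); rewrite -compDl !subrr comp0l. Qed.

Lemma compNr X Y Z (g : hom Y Z) (f : hom X Y) : g \o (- f) = - (g \o f).
Proof. by apply: (addrI (g \o f)); rewrite -compDr !subrr comp0r. Qed.

Lemma is_zeroP X : is_zero X <-> idm X = 0.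
Proof.
split=> [[f [g [gf _]]]|id0]; first by rewrite -gf (zob_terminal f) comp0r.
exists 0; exists 0; split; first by rewrite comp0r.
by rewrite comp0r; apply/esym/zob_initial.
Qed.

Lemma from_zero X Y (f : hom X Y) : is_zero X -> f = 0.
Proof. by move/is_zeroP=> X0; rewrite -(compm1 f) X0 comp0r. Qed.

Lemma to_zero X Y (f : hom X Y) : is_zero Y -> f = 0.
Proof. by move/is_zeroP=> Y0; rewrite -(comp1m f) Y0 comp0l. Qed.

Lemma iso_mono X Y (f : hom X Y) : is_iso f -> mono f.
Proof.
move=> [f' [f'f _]] Z g h fgh.
by rewrite -(comp1m g) -(comp1m h) -f'f -!compA fgh.
Qed.

Lemma iso_epi X Y (f : hom X Y) : is_iso f -> epi f.
Proof.
move=> [f' [_ ff']] Z g h gfh.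
by rewrite -(compm1 g) -(compm1 h) -ff' !compA gfh.
Qed.

Lemma iso_id X : is_iso (idm X).
Proof. by exists (idm X); rewrite comp1m. Qed.

Lemma comp_mono X Y Z (g : hom Y Z) (f : hom X Y) :
  mono g -> mono f -> mono (g \o f).
Proof. by move=> mg mf W h k; rewrite -!compA => /mg /mf. Qed.

Lemma comp_epi X Y Z (g : hom Y Z) (f : hom X Y) :
  epi g -> epi f -> epi (g \o f).
Proof. by move=> eg ef W h k; rewrite !compA => /ef /eg. Qed.

Lemma isomorphic_sym X Y : isomorphic X Y -> isomorphic Y X.
Proof. by move=> [f [g [gf fg]]]; exists g; exists f. Qed.

Lemma isomorphic_trans X Y Z :
  isomorphic X Y -> isomorphic Y Z -> isomorphic X Z.
Proof.
move=> [f [f' [f'f ff']]] [g [g' [g'g gg']]].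
exists (g \o f); exists (f' \o g'); split.
  by rewrite compA -(compA f') g'g compm1.
by rewrite compA -(compA g) ff' compm1.
Qed.

Lemma is_zero_iso X Y : isomorphic X Y -> is_zero X -> is_zero Y.
Proof. by move=> /isomorphic_sym; apply: isomorphic_trans. Qed.

Lemma mono0P X Y (f : hom X Y) :
  mono f <-> forall Z (h : hom Z X), f \o h = 0 -> h = 0.
Proof.
split=> [mf Z h fh0|f0 Z g h fgh]; first by apply: mf; rewrite fh0 comp0r.
apply/subr0_eq/f0.
by rewrite compDr compNr fgh subrr.
Qed.

Lemma epi0P X Y (f : hom X Y) :
  epi f <-> forall Z (h : hom Y Z), h \o f = 0 -> h = 0.
Proof.
split=> [ef Z h fh0|f0 Z g h fgh]; first by apply: ef; rewrite fh0 comp0l.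
apply/subr0_eq/f0.
by rewrite compDl compNl fgh subrr.
Qed.

Lemma kernel_mono X Y (f : hom X Y) K (k : hom K X) : is_kernel f k -> mono k.
Proof.
move=> [fk kP]; apply/mono0P=> Z h kh0.
have [|l [_ lu]] := kP Z (k \o h); first by rewrite compA fk comp0l.
by rewrite -(lu h) // (lu 0) // comp0r kh0.
Qed.

Lemma cokernel_epi X Y (f : hom X Y) Q (q : hom Y Q) : is_cokernel f q -> epi q.
Proof.
move=> [qf qP]; apply/epi0P=> Z h hq0.
have [|l [_ lu]] := qP Z (h \o q); first by rewrite -compA qf comp0r.
by rewrite -(lu h) // (lu 0) // comp0l hq0.
Qed.

(** A kernel-cokernel pair is recognised on the kernel side alone, because an
    epi is normal and therefore the cokernel of its kernel. *)
Lemma short_exactP X Y Z (f : hom X Y) (g : hom Y Z) :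
  short_exact f g <->
  [/\ mono f, epi g, g \o f = 0 &
      forall W (h : hom W Y), g \o h = 0 -> exists l, f \o l = h].
Proof.
split=> [[kf cg]|[mf eg gf fP]].
  split; [exact: kernel_mono kf|exact: cokernel_epi cg|exact: kf.1|].
  by move=> W h /(kf.2 W h) [l [<- _]]; exists l.
split; split=> // W h.
  move=> /fP [l fl]; exists l; split=> // l' fl'.
  by apply: mf; rewrite fl fl'.
have [V [w [gw wP]]] := epi_normal eg.
have [l wl] := fP _ _ gw.
by move=> hf; apply: wP; rewrite -wl compA hf comp0l.
Qed.

Lemma exact_mono X Y Z (f : hom X Y) (g : hom Y Z) : short_exact f g -> mono f.
Proof. by case/short_exactP. Qed.

Lemma exact_epi X Y Z (f : hom X Y) (g : hom Y Z) : short_exact f g -> epi g.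
Proof. by case/short_exactP. Qed.

Lemma exact_comp0 X Y Z (f : hom X Y) (g : hom Y Z) :
  short_exact f g -> g \o f = 0.
Proof. by case/short_exactP. Qed.

Lemma exact_lift X Y Z (f : hom X Y) (g : hom Y Z) W (h : hom W Y) :
  short_exact f g -> g \o h = 0 -> exists l, f \o l = h.
Proof. by case/short_exactP=> _ _ _; apply. Qed.

Lemma exact_desc X Y Z (f : hom X Y) (g : hom Y Z) W (h : hom Y W) :
  short_exact f g -> h \o f = 0 -> exists l, l \o g = h.
Proof. by move=> [_ [_ gP]] /gP [l [lg _]]; exists l. Qed.

Lemma epi_exact X Y (g : hom X Y) :
  epi g -> exists K (k : hom K X), short_exact k g.
Proof.
move=> eg; have [K [k kP]] := has_kernels g; exists K, k.
apply/short_exactP; split=> //; [exact: kernel_mono kP|exact: kP.1|].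
by move=> W h /(kP.2 W h) [l [<- _]]; exists l.
Qed.

Lemma mono_exact X Y (f : hom X Y) :
  mono f -> exists Q (q : hom Y Q), short_exact f q.
Proof.
move=> mf; have [Q [q qP]] := has_cokernels f; exists Q, q.
apply/short_exactP; split=> //; [exact: cokernel_epi qP|exact: qP.1|].
move=> W h qh; have [Z [g [gf gP]]] := mono_normal mf.
have [l [lq _]] := qP.2 _ _ gf.
by have [|l' [<- _]] := gP W h; [rewrite -lq -compA qh comp0r|exists l'].
Qed.

Lemma mono_epi_iso X Y (f : hom X Y) : mono f -> epi f -> is_iso f.
Proof.
move=> mf ef; have [Q [q fq]] := mono_exact mf.
have q0 : q = 0 by apply: (epi0P f).1 => //; exact: exact_comp0 fq.
have [|g fg] := exact_lift (h := idm Y) fq; first by rewrite q0 comp0l.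
exists g; split=> //; apply: mf.
by rewrite compA fg comp1m compm1.
Qed.

Lemma exact_iso_left X Y Z (f : hom X Y) (g : hom Y Z) :
  short_exact f g -> is_zero Z -> is_iso f.
Proof.
move=> fg Z0; apply: mono_epi_iso (exact_mono fg) _.
apply/epi0P=> W h /(exact_desc fg) [l <-].
by rewrite (from_zero l Z0) comp0l.
Qed.

Lemma exact_iso_right X Y Z (f : hom X Y) (g : hom Y Z) :
  short_exact f g -> is_zero X -> is_iso g.
Proof.
move=> fg X0; apply: mono_epi_iso _ (exact_epi fg).
apply/mono0P=> W h /(exact_lift fg) [l <-].
by rewrite (to_zero l X0) comp0r.
Qed.

Lemma exact_split X Y Z (f : hom X Y) (g : hom Y Z) (r : hom Y X) :
  short_exact f g -> r \o f = idm X -> split_epi g.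
Proof.
move=> fg rf.
have [|s sg] := exact_desc (h := idm Y - (f \o r)) fg.
  by rewrite compDl compNl -compA rf compm1 comp1m subrr.
exists s; apply: (exact_epi fg).
rewrite -compA sg compDr compNr compA (exact_comp0 fg) comp0l subr0.
by rewrite compm1 comp1m.
Qed.

(** The image is the kernel i of the cokernel of f. If g vanishes on the first
    factor p, then f factors through i \o ker g, a mono and hence the kernel
    of some h. As h kills f, it also kills i, so i factors through i \o ker g
    and g = 0. *)
Lemma image_factorization X Y (f : hom X Y) :
  exists I (p : hom X I) (i : hom I Y), [/\ epi p, mono i & f = i \o p].
Proof.
have [Q [c [cf cP]]] := has_cokernels f.
have [I [i iP]] := has_kernels c.
have [p [ip _]] := iP.2 _ _ cf.
have mi := kernel_mono iP.
exists I, p, i; split=> //; apply/epi0P=> Z g gp.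
have [K [k kP]] := has_kernels g.
have [p' [kp' _]] := kP.2 _ _ gp.
have [W [h [hik hP]]] := mono_normal (comp_mono mi (kernel_mono kP)).
have [|h' [h'c _]] := cP _ h.
  by rewrite -ip -kp' compA compA -(compA h) hik comp0l.
have [|l [il _]] := hP _ i; first by rewrite -h'c -compA iP.1 comp0r.
have kl : k \o l = idm I by apply: mi; rewrite compA il compm1.
by rewrite -(compm1 g) -kl compA kP.1 comp0l.
Qed.

(** With k the kernel of the epi phi = [g, -v] from the biproduct, phi is the
    cokernel of k; if h kills b, then h \o prj2 kills k, so it factors through phi, by a
    map that vanishes because h \o prj2 is zero on X. *)
Lemma pullback_epi X V W P (g : hom X V) (v : hom W V) (b : hom P W) :
  (forall Z (x : hom Z X) (w : hom Z W), g \o x = v \o w ->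
     exists p, b \o p = w) ->
  epi g -> epi b.
Proof.
move=> bP /epi0P eg; apply/epi0P=> Z h hb.
pose phi := (g \o prj1 X W) - (v \o prj2 X W).
have phi1 : phi \o inj1 X W = g.
  by rewrite compDl compNl -!compA prj1_inj1 prj2_inj1 comp0r subr0 compm1.
have [|K [k kphi]] := @epi_exact _ _ phi.
  apply/epi0P=> Y l lphi; apply: eg.
  by rewrite -phi1 compA lphi comp0l.
have [|p bp] := bP K (prj1 X W \o k) (prj2 X W \o k).
  apply/subr0_eq; rewrite !compA -compNl -compDl.
  exact: exact_comp0 kphi.
have [|l lphi] := exact_desc (h := h \o prj2 X W) kphi.
  by rewrite -compA -bp compA hb comp0l.
have l0 : l = 0.
  by apply: eg; rewrite -phi1 compA lphi -compA prj2_inj1 comp0r.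
by rewrite -(compm1 h) -(prj2_inj2 X W) compA -lphi l0 !comp0l.
Qed.

Lemma exact_pullback U X V W (f : hom U X) (g : hom X V) (v : hom W V) :
  short_exact f g ->
  exists P (u : hom U P) (b : hom P W) (a : hom P X),
    [/\ short_exact u b, a \o u = f & g \o a = v \o b].
Proof.
move=> fg.
pose phi := (g \o prj1 X W) - (v \o prj2 X W).
have [P [k kphi]] := has_kernels phi.
have lift Z (x : hom Z X) (w : hom Z W) : g \o x = v \o w ->
    exists p, prj1 X W \o k \o p = x /\ prj2 X W \o k \o p = w.
  move=> gxvw.
  have [|p [kp _]] := kphi.2 _ ((inj1 X W \o x) + (inj2 X W \o w)).
    rewrite compDr !compDl !compNl -!compA.
    rewrite !(compA (prj1 _ _)) !(compA (prj2 _ _)).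
    rewrite prj1_inj1 prj1_inj2 prj2_inj1 prj2_inj2.
    by rewrite !comp0l !comp0r !comp1m subr0 add0r gxvw subrr.
  exists p; rewrite -!compA kp !compDr !compA.
  rewrite prj1_inj1 prj1_inj2 prj2_inj1 prj2_inj2.
  by rewrite !comp0l !comp1m addr0 add0r.
have comm : g \o (prj1 X W \o k) = v \o (prj2 X W \o k).
  by apply/subr0_eq; rewrite !compA -compNl -compDl kphi.1.
have [|u [au bu]] := lift U f 0; first by rewrite comp0r (exact_comp0 fg).
exists P, u, (prj2 X W \o k), (prj1 X W \o k); split=> //.
apply/short_exactP; split=> //.
- apply/mono0P=> Z h uh; apply: (mono0P f).1 (exact_mono fg) _ _ _.
  by rewrite -au -compA uh comp0r.
- apply: (pullback_epi (v := v)) (exact_epi fg) => Z x w /lift [p [_ bp]].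
  by exists p.
- move=> Z h bh.
  have [|l fl] := exact_lift (h := prj1 X W \o k \o h) fg.
    by rewrite compA comm -compA bh comp0r.
  exists l; apply: (kernel_mono kphi).
  rewrite -(comp1m (k \o _)) -[RHS]comp1m -oplus_id !compDl -!compA.
  rewrite !(compA (prj1 _ _)) !(compA (prj2 _ _)) !(compA (_ \o k)).
  by rewrite au bu fl bh comp0l.
Qed.

(** The preimage in X of a subobject V' of V is an extension of V' by U, for
    V' the kernel of a given epi s. *)
Lemma exact_restrict U X V V' Q X'
    (f : hom U X) (g : hom X V) (k : hom V' V) (s : hom V Q) (x : hom X' X) :
  short_exact f g -> short_exact k s -> short_exact x (s \o g) ->
  exists (u : hom U X') (w : hom X' V'), short_exact u w.
Proof.
move=> fg ks xsg.
have [|u xu] := exact_lift (h := f) xsg.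
  by rewrite -compA (exact_comp0 fg) comp0r.
have [|w kw] := exact_lift (h := g \o x) ks.
  by rewrite compA (exact_comp0 xsg).
exists u, w; apply/short_exactP; split.
- apply/mono0P=> Z h uh; apply: (mono0P f).1 (exact_mono fg) _ _ _.
  by rewrite -xu -compA uh comp0r.
- apply: (pullback_epi (v := k)) (exact_epi fg) => Z a b gakb.
  have [|p xp] := exact_lift (h := a) xsg.
    by rewrite -compA gakb compA (exact_comp0 ks) comp0l.
  by exists p; apply: (exact_mono ks); rewrite compA kw -compA xp.
- by apply: (exact_mono ks); rewrite compA kw -compA xu comp0r (exact_comp0 fg).
- move=> Z h wh.
  have [|l fl] := exact_lift (h := x \o h) fg.
    by rewrite compA -kw -compA wh comp0r.
  by exists l; apply: (exact_mono xsg); rewrite compA xu.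
Qed.

(** If U already surjects onto the quotient Q of X, then U and the kernel X'
    of X -> Q together span X, so X' still surjects onto X / U. *)
Lemma exact_restrict_onto U X V Q X' U'
    (f : hom U X) (g : hom X V) (s : hom X Q) (x : hom X' X) (u : hom U' U) :
  short_exact f g -> short_exact x s -> short_exact u (s \o f) ->
  exists w : hom U' X', short_exact w (g \o x).
Proof.
move=> fg xs us.
have [|w xw] := exact_lift (h := f \o u) xs.
  by rewrite compA (exact_comp0 us).
exists w; apply/short_exactP; split.
- apply/mono0P=> Z h wh; apply: (mono0P u).1 (exact_mono us) _ _ _.
  apply: (mono0P f).1 (exact_mono fg) _ _ _.
  by rewrite compA -xw -compA wh comp0r.
- apply/epi0P=> Z h; rewrite compA => /(exact_desc xs) [l ls].
  have l0 : l = 0.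
    apply: (epi0P _).1 (exact_epi us) _ _ _.
    by rewrite compA ls -compA (exact_comp0 fg) comp0r.
  apply: (epi0P _).1 (exact_epi fg) _ _ _.
  by rewrite -ls l0 comp0l.
- by rewrite -compA xw compA (exact_comp0 fg) comp0l.
- move=> Z h; rewrite -compA => /(exact_lift fg) [l fl].
  have [|t ut] := exact_lift (h := l) us.
    by rewrite -compA fl compA (exact_comp0 xs) comp0l.
  exists t; apply: (exact_mono xs).
  by rewrite compA xw -compA ut fl.
Qed.

Lemma oplus_exact X Y : short_exact (inj1 X Y) (prj2 X Y).
Proof.
apply/short_exactP; split; last 1 first.
- move=> W h ph; exists (prj1 X Y \o h).
  by rewrite -[RHS]comp1m -oplus_id compDl -!compA ph comp0r addr0.
- apply/mono0P=> Z h ih.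
  by rewrite -(comp1m h) -(prj1_inj1 X Y) -compA ih comp0r.
- apply/epi0P=> Z h hp.
  by rewrite -(compm1 h) -(prj2_inj2 X Y) compA hp comp0l.
- exact: prj2_inj1.
Qed.

Lemma prj1_epi X Y : epi (prj1 X Y).
Proof.
apply/epi0P=> Z h hp.
by rewrite -(compm1 h) -(prj1_inj1 X Y) compA hp comp0l.
Qed.

Lemma hom_zero_oplusl X Y Z :
  hom_zero (oplus X Y) Z <-> hom_zero X Z /\ hom_zero Y Z.
Proof.
split=> [h0|[hX hY] f].
  split=> f.
    by rewrite -(compm1 f) -(prj1_inj1 X Y) compA (h0 (f \o _)) comp0l.
  by rewrite -(compm1 f) -(prj2_inj2 X Y) compA (h0 (f \o _)) comp0l.
rewrite -(compm1 f) -oplus_id compDr !compA.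
by rewrite (hX (f \o _)) (hY (f \o _)) !comp0l addr0.
Qed.

Lemma hom_zero_oplusr X Y Z :
  hom_zero Z (oplus X Y) <-> hom_zero Z X /\ hom_zero Z Y.
Proof.
split=> [h0|[hX hY] f].
  split=> f.
    by rewrite -(comp1m f) -(prj1_inj1 X Y) -compA (h0 (_ \o f)) comp0r.
  by rewrite -(comp1m f) -(prj2_inj2 X Y) -compA (h0 (_ \o f)) comp0r.
rewrite -(comp1m f) -oplus_id compDl -!compA.
by rewrite (hX (_ \o f)) (hY (_ \o f)) !comp0r addr0.
Qed.

Lemma hom_zero_suml (I : eqType) (r : seq I) (N : I -> obj A) Z :
  hom_zero (\big[oplus/zob]_(j <- r) N j) Z <->
  forall j, j \in r -> hom_zero (N j) Z.
Proof.
elim: r => [|j r IH].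
  by rewrite big_nil; split=> // _ f; apply: zob_initial.
rewrite big_cons hom_zero_oplusl IH; split.
  by move=> [h1 h2] l; rewrite inE => /predU1P[->|/h2].
by move=> h; split=> [|l lr]; apply: h; rewrite inE ?eqxx // lr orbT.
Qed.

Lemma hom_zero_sumr (I : eqType) (r : seq I) (N : I -> obj A) Z :
  hom_zero Z (\big[oplus/zob]_(j <- r) N j) <->
  forall j, j \in r -> hom_zero Z (N j).
Proof.
elim: r => [|j r IH].
  by rewrite big_nil; split=> // _ f; apply: zob_terminal.
rewrite big_cons hom_zero_oplusr IH; split.
  by move=> [h1 h2] l; rewrite inE => /predU1P[->|/h2].
by move=> h; split=> [|l lr]; apply: h; rewrite inE ?eqxx // lr orbT.
Qed.

(** A nontrivial decomposition would give an idempotent e that is neither zero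
    nor invertible. *)
Lemma brick_indecomposable X : brick X -> indecomposable X.
Proof.
move=> [X0 Xb]; split; first by move/is_zeroP.
move=> Y Z [f [g [gf fg]]].
pose e := g \o (inj1 Y Z \o prj1 Y Z) \o f.
have [e0|/Xb /iso_mono /mono0P e_mono] := pselect (e = 0).
  left; apply/is_zeroP.
  have ip0 : inj1 Y Z \o prj1 Y Z = 0.
    rewrite -(comp1m (_ \o _)) -fg -(compm1 (_ \o _)) -fg.
    have -> : forall h, f \o g \o h \o (f \o g) = f \o (g \o h \o f) \o g.
      by move=> h; rewrite !compA.
    by rewrite -/e e0 comp0r comp0l.
  rewrite -(prj1_inj1 Y Z) -[X in X \o _]comp1m -(prj1_inj1 Y Z).
  by rewrite -(compA (prj1 _ _)) ip0 comp0r comp0l.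
right; apply/is_zeroP.
have gi0 : g \o inj2 Y Z = 0.
  apply: e_mono; rewrite /e !compA -(compA _ f) fg compm1.
  by rewrite -compA prj1_inj2 comp0r.
by rewrite -(prj2_inj2 Y Z) -(comp1m (inj2 _ _)) -fg -(compA f) gi0 !comp0r.
Qed.

End AbelianCategory.

(** * Filtrations and extension closed classes *)

Section Filtrations.
Import GRing.Theory Defs.
Local Open Scope cat_scope.
Variable A : abelianCat.
Implicit Types X Y Z W P U V Q K L M : obj A.
Implicit Types C S : set (obj A).

Lemma mono_from_zero X Y (f : hom X Y) : mono f -> is_zero Y -> is_zero X.
Proof.
by move=> /mono0P mf Y0; apply/is_zeroP/mf/to_zero.
Qed.

Lemma epi_to_zero X Y (f : hom X Y) : epi f -> is_zero X -> is_zero Y.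
Proof.
by move=> /epi0P mf Y0; apply/is_zeroP/mf/from_zero.
Qed.

Lemma zero_exact X : short_exact (0%R : hom zob X) (idm X).
Proof.
apply/short_exactP; split.
- by apply/mono0P=> Z h _; apply: zob_terminal.
- by move=> Z g h; rewrite !compm1.
- by rewrite comp0r.
- by move=> W h; rewrite comp1m => ->; exists 0%R; rewrite comp0r.
Qed.

Lemma iso_exact X Y (f : hom X Y) :
  is_iso f -> short_exact f (0%R : hom Y zob).
Proof.
move=> fi; apply/short_exactP; split; first exact: iso_mono.
- by apply/epi0P=> Z h _; apply: zob_initial.
- by rewrite comp0l.
- move=> W h _; have [g [_ fg]] := fi.
  by exists (g \o h); rewrite compA fg comp1m.
Qed.

Lemma is_zero_zob : is_zero (zob : obj A).
Proof. by exists (idm zob); apply: iso_id. Qed.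

Definition extension_closed C :=
  (forall X, is_zero X -> C X) /\
  forall X Y Z (f : hom X Y) (g : hom Y Z),
    short_exact f g -> C X -> C Z -> C Y.

Lemma extension_closed_iso C X Y :
  extension_closed C -> isomorphic X Y -> C X -> C Y.
Proof.
move=> [C0 Cext] [f /iso_exact fi] CX.
exact: Cext fi CX (C0 _ is_zero_zob).
Qed.

Lemma rperp_extension_closed C : extension_closed (rperp C).
Proof.
split=> [X X0 Y _ f|X Y Z f g fg CX CZ W CW h]; first exact: to_zero.
have [|l <-] := exact_lift (h := h) fg; first exact: CZ.
by rewrite (CX _ CW l) comp0r.
Qed.

Lemma lperp_extension_closed C : extension_closed (lperp C).
Proof.
split=> [X X0 Y _ f|X Y Z f g fg CX CZ W CW h]; first exact: from_zero.
have [|l <-] := exact_desc (h := h) fg; first exact: CX.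
by rewrite (CZ _ CW l) comp0l.
Qed.

(** A filtration described from the top: the last step is an extension of an
    object of C by an object that is filtered in n steps. Unlike chains of
    subobjects, this form can be used for inductions without tracking
    inclusions into a fixed ambient object. *)
Inductive filtered C : nat -> obj A -> Prop :=
| filtered0 X : is_zero X -> filtered C 0 X
| filteredS n U X Q (f : hom U X) (g : hom X Q) :
    short_exact f g -> C Q -> filtered C n U -> filtered C n.+1 X.

(** Induction on the filtration of V: the preimage in X of the last proper
    term of that filtration is filtered, and has the same top quotient. *)
Lemma filtered_ext C a b U X V (f : hom U X) (g : hom X V) :
  short_exact f g -> filtered C a U -> filtered C b V -> filtered C (a + b) X.
Proof.
move=> fg FU FV; elim: FV X f g fg => {b V}
    [V V0|b V' V Q k s ks CQ FV' IH] X f g fg.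
  have [h [hf fh]] := exact_iso_left fg V0.
  rewrite addn0; case: a U / FU f fg h hf fh
      => [U U0|a U' U Q k s ks CQ FU'] f fg h hf fh.
    by apply/filtered0/(is_zero_iso _ U0); exists f, h.
  apply: (@filteredS _ _ _ _ _ (f \o k) (s \o h)) CQ FU'.
  apply/short_exactP; split.
  - exact: comp_mono (exact_mono fg) (exact_mono ks).
  - by apply: comp_epi (exact_epi ks) _; apply: iso_epi; exists f.
  - by rewrite compA -(compA s) hf compm1 (exact_comp0 ks).
  - move=> W x; rewrite -compA => /(exact_lift ks) [l kl].
    by exists l; rewrite -compA kl compA fh comp1m.
have [X' [x xsg]] := epi_exact (comp_epi (exact_epi ks) (exact_epi fg)).
have [u [w uw]] := exact_restrict fg ks xsg.
by rewrite addnS; apply: filteredS xsg CQ (IH _ _ _ uw).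
Qed.

Lemma filtered_iso C n X Y : isomorphic X Y -> filtered C n X -> filtered C n Y.
Proof.
move=> [f /iso_exact fi] FX; rewrite -(addn0 n).
exact: filtered_ext fi FX (filtered0 _ is_zero_zob).
Qed.

Lemma mono_id X : mono (idm X).
Proof. exact/iso_mono/iso_id. Qed.

Lemma filtrationP C n X :
  (exists F : nat -> subobj X, filtration (fun=> C) n F) <-> filtered C n X.
Proof.
split=> [[F [F0 Fn FS]]|].
  apply: (@filtered_iso _ _ (F n)); first by exists (sub_mor (F n)).
  elim: n {Fn} FS => [|n IH] FS; first exact: filtered0.
  have [v [Q [q [_ vq CQ]]]] := FS n (ltnSn n).
  apply: filteredS vq CQ (IH _) => i lt_in.
  exact/FS/ltnW.
elim=> {n X} [X X0|n U X Q f g fg CQ _ [F [F0 Fn FS]]].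
  exists (fun=> SubObj (@mono_id X)); split=> //=; exact: iso_id.
pose F' i := if i <= n
  then SubObj (comp_mono (exact_mono fg) (@sub_mono _ _ (F i)))
  else SubObj (@mono_id X).
exists F'; split=> [//||i]; first by rewrite /F' ltnn; apply: iso_id.
rewrite ltnS leq_eqVlt => /predU1P[->|lt_in]; rewrite /F'.
  rewrite leqnn ltnn; exists (f \o sub_mor (F n)), Q, g; split=> //=.
    by rewrite comp1m.
  apply/short_exactP; split.
  - exact: comp_mono (exact_mono fg) (@sub_mono _ _ (F n)).
  - exact: exact_epi fg.
  - by rewrite compA (exact_comp0 fg) comp0l.
  - move=> W h /(exact_lift fg) [l <-]; have [k [_ Fk]] := Fn.
    by exists (k \o l); rewrite -compA (compA _ k) Fk comp1m.
rewrite lt_in (ltnW lt_in).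
have [v [R [q [Fv vq CR]]]] := FS i lt_in.
by exists v, R, q; split=> //=; rewrite -compA Fv.
Qed.

Definition iso_indecomposable_of S : set (obj A) :=
  [set Q | exists Y, [/\ S Y, indecomposable Y & isomorphic Q Y]].

Lemma FiltP S X :
  Filt S X <-> exists n, filtered (iso_indecomposable_of S) n X.
Proof. by split=> -[n /filtrationP]; exists n. Qed.

Lemma Filt_extension_closed S : extension_closed (Filt S).
Proof.
split=> [X X0|X Y Z f g fg /FiltP [a FX] /FiltP [b FZ]].
  by apply/FiltP; exists 0; apply: filtered0.
by apply/FiltP; exists (a + b); apply: filtered_ext fg FX FZ.
Qed.

(** Together with [Filt_extension_closed], this makes Filt S the smallest
    extension closed class when all of S is indecomposable. *)
Lemma Filt_min S C : extension_closed C -> S `<=` C -> Filt S `<=` C.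
Proof.
move=> extC SC X /FiltP [n FX].
elim: FX => {n X} [X X0|n U X Q f g fg [Y [SY _ QY]] _ CU]; first exact: extC.1.
apply: extC.2 fg CU _.
exact: extension_closed_iso extC (isomorphic_sym QY) (SC _ SY).
Qed.

Lemma Filt_base S X : S X -> indecomposable X -> Filt S X.
Proof.
move=> SX Xi; apply/FiltP; exists 1.
apply: filteredS (zero_exact X) _ (filtered0 _ is_zero_zob).
by exists X; split=> //; exists (idm X); apply: iso_id.
Qed.

Lemma Filt_mono S S' : S `<=` S' -> Filt S `<=` Filt S'.
Proof.
move=> SS' X /FiltP [n FX]; apply/FiltP; exists n.
elim: FX => {n X} [X X0|n U X Q f g fg [Y [SY Yi QY]] _ CU].
  exact: filtered0.
by apply: filteredS fg _ CU; exists Y; split=> //; apply: SS'.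
Qed.

End Filtrations.

(** * Length *)

Section Length.
Import GRing.Theory Defs.
Local Open Scope cat_scope.
Variable A : abelianCat.
Implicit Types X Y Z W P U V Q K L M S : obj A.

Lemma simple_epi U S (f : hom U S) : simple S -> f <> 0%R -> epi f.
Proof.
move=> [_ Ss] f0; have [I [p [i [ep mi fE]]]] := image_factorization f.
have [I0|ii] := Ss _ _ mi.
  by case: f0; rewrite fE (from_zero i I0) comp0l.
by rewrite fE; apply: comp_epi ep; apply: iso_epi.
Qed.

(** The top simple quotient S of X is a quotient of V if U maps to zero in S,
    and a quotient of U otherwise; removing it from that side leaves an exact
    sequence for the next term of the filtration. *)
Lemma filtered_simple_exact n U X V (f : hom U X) (g : hom X V) :
  short_exact f g -> filtered (@simple A) n X ->
  exists a b,
    [/\ a + b = n, filtered (@simple A) a U & filtered (@simple A) b V].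
Proof.
move=> fg FX; elim: FX U V f g fg => {n X}
    [X X0|n X' X S x s xs Ss FX' IH] U V f g fg.
  exists 0, 0; split=> //; apply: filtered0.
    exact: mono_from_zero (exact_mono fg) X0.
  exact: epi_to_zero (exact_epi fg) X0.
have [/(exact_desc fg) [s' s'g]|sf0] := pselect (s \o f = 0%R).
  have es' : epi s'.
    apply/epi0P=> Z h hs'; apply: (epi0P _).1 (exact_epi xs) _ _ _.
    by rewrite -s'g compA hs' comp0l.
  have [V' [k ks']] := epi_exact es'.
  rewrite -s'g in xs.
  have [u [w uw]] := exact_restrict fg ks' xs.
  have [a [b [<- FU FV]]] := IH _ _ _ _ uw.
  by exists a, b.+1; split; [rewrite addnS| |apply: filteredS ks' Ss FV].
have [U' [u us]] := epi_exact (simple_epi Ss sf0).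
have [w wgx] := exact_restrict_onto fg xs us.
have [a [b [<- FU FV]]] := IH _ _ _ _ wgx.
by exists a.+1, b; split; [rewrite addSn|apply: filteredS us Ss FU|].
Qed.

(** Superadditivity makes the length drop strictly for proper subobjects and
    proper quotients. *)
Definition length_function (len : obj A -> nat) :=
  (forall X, len X = 0 -> is_zero X) /\
  forall U X V (f : hom U X) (g : hom X V),
    short_exact f g -> len U + len V <= len X.

(** The length of X is the least number of steps of a filtration of X with
    simple quotients. *)
Lemma exists_length : length_category A -> exists len, length_function len.
Proof.
move=> lenA.
have minlen X : exists n, filtered (@simple A) n X /\
    forall k, filtered (@simple A) k X -> n <= k.
  have [n /filtrationP FX] := lenA X.
  have exn : exists n, `[< filtered (@simple A) n X >].
    by exists n; apply/asboolP.
  case: (ex_minnP exn) => k /asboolP Fk kmin; exists k; split=> // l Fl.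
  exact/kmin/asboolP.
have [len lenP] := choice minlen; exists len; split=> [X X0|U X V f g fg].
  by have [FX _] := lenP X; rewrite X0 in FX; inversion FX.
have [a [b [<- FU FV]]] := filtered_simple_exact fg (lenP X).1.
by apply: leq_add; [apply: (lenP U).2|apply: (lenP V).2].
Qed.

Variable len : obj A -> nat.
Hypothesis lenP : length_function len.

Lemma len_gt0 X : ~ is_zero X -> 0 < len X.
Proof. by move=> X0; rewrite lt0n; apply/eqP=> /lenP.1. Qed.

Lemma len_sub U X V (f : hom U X) (g : hom X V) :
  short_exact f g -> ~ is_zero V -> len U < len X.
Proof.
move=> fg /len_gt0 V0; apply: leq_trans (lenP.2 _ _ _ _ _ fg).
by rewrite -addn1 leq_add2l.
Qed.

Lemma len_quotient U X V (f : hom U X) (g : hom X V) :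
  short_exact f g -> ~ is_zero U -> len V < len X.
Proof.
move=> fg /len_gt0 U0; apply: leq_trans (lenP.2 _ _ _ _ _ fg).
by rewrite -add1n leq_add2r.
Qed.

Lemma mono_endo_iso X (f : hom X X) : mono f -> is_iso f.
Proof.
move=> mf; have [Q [q fq]] := mono_exact mf.
apply: (exact_iso_left fq); apply: contrapT => /(len_sub fq).
by rewrite ltnn.
Qed.

Lemma len_proper_quotient X Y (q : hom X Y) :
  epi q -> ~ is_iso q -> len Y < len X.
Proof.
move=> eq nq; have [K [k kq]] := epi_exact eq.
by apply: (len_quotient kq) => /(exact_iso_right kq).
Qed.

(** * Torsion pairs *)

Section Torsion.
Variable T : set (obj A).
Hypothesis torsT : torsion_class T.
Hypothesis T0 : forall X, is_zero X -> T X.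

Lemma torsion_extension_closed : extension_closed T.
Proof. by case: torsT. Qed.

Lemma torsion_quotient X Y (f : hom X Y) : epi f -> T X -> T Y.
Proof. by case: torsT => _ _; apply. Qed.

(** The image of f is a subobject of a torsion free object; were it a proper
    quotient of X, it would also be torsion, hence zero. *)
Lemma torsion_free_hom_mono X Y (f : hom X Y) :
  rperp T Y -> f <> 0%R ->
  (forall Q (q : hom X Q), epi q -> ~ is_iso q -> T Q) -> mono f.
Proof.
move=> FY f0 Xq; have [I [p [i [ep mi fE]]]] := image_factorization f.
have [/iso_mono mp|np] := pselect (is_iso p).
  by rewrite fE; apply: comp_mono.
by case: f0; rewrite fE (FY _ (Xq _ _ ep np) i) comp0l.
Qed.

Lemma not_rperp_sub X :
  ~ rperp T X -> exists I (i : hom I X), [/\ mono i, T I & ~ is_zero I].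
Proof.
move=> nF; apply: contrapT => nI; apply: nF => Y TY f; apply: contrapT => f0.
have [I [p [i [ep mi fE]]]] := image_factorization f.
apply: nI; exists I, i; split=> //; first exact: torsion_quotient ep TY.
by move=> I0; apply: f0; rewrite fE (from_zero i I0) comp0l.
Qed.

(** If X is not torsion free, divide by a nonzero torsion subobject I; the
    torsion part of X is the preimage of that of the shorter object X / I. *)
Lemma torsion_pair X : exists U V (f : hom U X) (g : hom X V),
  [/\ short_exact f g, T U & rperp T V].
Proof.
have [n] := ubnP (len X); elim: n X => // n IH X ltXn.
have [FX|/not_rperp_sub [I [i [mi TI I0]]]] := pselect (rperp T X).
  exists zob, X, 0%R, (idm X); split=> //; first exact: zero_exact.
  by apply: T0; apply: is_zero_zob.
have [Y [q iq]] := mono_exact mi.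
have [|U [V [k [s [ks TU FV]]]]] := IH Y.
  exact: leq_trans (len_quotient iq I0) ltXn.
have [X' [x xsq]] := epi_exact (comp_epi (exact_epi ks) (exact_epi iq)).
have [u [w uw]] := exact_restrict iq ks xsq.
exists X', V, x, (s \o q); split=> //.
exact: torsion_extension_closed.2 uw TI TU.
Qed.

(** A decomposable object of T is an extension of its two summands, which are
    proper quotients and hence shorter objects of T. *)
Lemma torsion_indecomposables X : T X -> Filt T X.
Proof.
have [n] := ubnP (len X); elim: n X => // n IH X ltXn TX.
have [X0|X0] := pselect (is_zero X); first exact: (Filt_extension_closed T).1.
have [Xi|Xd] := pselect (indecomposable X); first exact: Filt_base.
have [Y [Z [XYZ Y0 Z0]]] : exists Y Z,
    [/\ isomorphic X (oplus Y Z), ~ is_zero Y & ~ is_zero Z].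
  apply: contrapT => nd; apply: Xd; split=> // Y Z XYZ.
  have [Y0|Y0] := pselect (is_zero Y); first by left.
  by right; apply: contrapT => Z0; apply: nd; exists Y, Z.
have [h [g [hg gh]]] := XYZ.
have hi : is_iso h by exists g.
apply: (extension_closed_iso (Filt_extension_closed T) (isomorphic_sym XYZ)).
have FX W (p : hom (oplus Y Z) W) : epi p -> ~ is_iso p -> Filt T W.
  move=> ep np; have eph := comp_epi ep (iso_epi hi).
  apply: IH; last exact: torsion_quotient eph TX.
  apply: leq_trans (len_proper_quotient eph _) ltXn => phi.
  apply: np; apply: mono_epi_iso ep; apply/mono0P=> V k pk.
  have: p \o h \o (g \o k) = 0%R by rewrite compA -(compA p) gh compm1.
  move/((mono0P _).1 (iso_mono phi)) => gk.
  by rewrite -(comp1m k) -gh -compA gk comp0r.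
have YZ := oplus_exact Y Z.
apply: (Filt_extension_closed T).2 (YZ) _ _.
  apply: (FX _ (prj1 Y Z)) (@prj1_epi _ Y Z) _ => /iso_mono/mono0P mp.
  apply/Z0/is_zeroP.
  by rewrite -(prj2_inj2 Y Z) (mp _ _ (prj1_inj2 Y Z)) comp0r.
apply: (FX _ (prj2 Y Z)) (exact_epi YZ) _ => /iso_mono/mono0P mp.
by apply/Y0/is_zeroP; rewrite -(prj1_inj1 Y Z) (mp _ _ (prj2_inj1 Y Z)) comp0r.
Qed.

End Torsion.
End Length.

(** * Covers of torsion classes *)

Section Cover.
Import GRing.Theory Defs.
Local Open Scope cat_scope.
Variable A : abelianCat.
Variable len : obj A -> nat.
Hypothesis lenP : length_function len.
Variables T T' : set (obj A).
Hypothesis T0 : forall X, is_zero X -> T X.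
Hypothesis TT' : tors_cover T T'.
Implicit Types X Y Z L M : obj A.

(** The objects Y of T' with Hom(Y, L) = 0 form a torsion class between T and
    T', distinct from T' because it misses L; so this class is T. *)
Lemma cover_left_orthogonal L X :
  T' L -> rperp T L -> ~ is_zero L -> T' X -> hom_zero X L -> T X.
Proof.
case: TT' => torsT torsT' [subTT' _] noT'' T'L FL L0 T'X XL.
apply: contrapT => nTX.
pose T'' := T' `&` lperp [set L].
have [lperp0 lperp_ext] := @lperp_extension_closed A [set L].
have torsT'' : torsion_class T''.
  have ext : extension_closed T''.
    split=> [Y Y0|Y Z W f g fg [T'Y YL] [T'W WL]].
      by split; [apply/subTT'/T0|apply: lperp0].
    split; last exact: lperp_ext fg YL WL.
    by case: torsT' => _ ext' _; apply: ext' fg T'Y T'W.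
  split; [|exact: ext.2|].
    by move=> Y Z YZ; apply: (extension_closed_iso ext YZ).
  move=> Y Z f ef [T'Y YL]; split; first exact: torsion_quotient ef T'Y.
  move=> W WE h; apply: (epi0P _).1 ef _ _ _; exact: YL.
apply: (noT'' T'' torsT''); split; split.
- by move=> Y TY; split; [apply: subTT'|move=> _ -> f; apply: FL].
- by move=> /(_ X) h; apply/nTX/h; split=> // _ ->.
- by move=> Y [].
- move=> /(_ L T'L) [_ /(_ L erefl (idm L))] L1.
  by apply/L0/is_zeroP.
Qed.

(** Any object of minimal length in T' but not in T will do. *)
Lemma cover_minimal_object : exists M,
  [/\ T' M, ~ T M & forall Q (q : hom M Q), epi q -> ~ is_iso q -> T Q].
Proof.
case: TT' => _ torsT' [subTT' ne] _.
have ex : exists n, `[< exists X, [/\ T' X, ~ T X & len X = n] >].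
  apply: contrapT => nex; apply: ne => X T'X; apply: contrapT => nTX.
  by apply: nex; exists (len X); apply/asboolP; exists X.
case: (ex_minnP ex) => n /asboolP [M [T'M nTM <-]] minM.
exists M; split=> // Q q eq nq; apply: contrapT => nTQ.
have: len M <= len Q.
  by apply/minM/asboolP; exists Q; split=> //; apply: torsion_quotient eq T'M.
by rewrite leqNgt (len_proper_quotient lenP eq nq).
Qed.

Section MinimalObject.
Variable M : obj A.
Hypothesis T'M : T' M.
Hypothesis nTM : ~ T M.
Hypothesis Mq : forall Q (q : hom M Q), epi q -> ~ is_iso q -> T Q.

Let M0 : ~ is_zero M. Proof. by move/T0. Qed.

(** A nonzero torsion subobject I would make M an extension of the proper
    quotient M / I by I, hence an object of T. *)
Lemma minimal_torsion_free : rperp T M.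
Proof.
case: TT' => torsT _ _ _; have Text := torsion_extension_closed torsT T0.
apply: contrapT => /(not_rperp_sub torsT) [I [i [mi TI I0]]].
have [Q [q iq]] := mono_exact mi.
apply/nTM/(Text.2 _ _ _ _ _ iq TI)/(Mq (exact_epi iq)) => /iso_mono mq.
have i0 : i = 0%R by apply: (mono0P _).1 mq _ _ _; apply: exact_comp0 iq.
by apply/I0/is_zeroP/((mono0P _).1 mi); rewrite i0 comp0l.
Qed.

Lemma minimal_brick : brick M.
Proof.
split; first by move/is_zeroP.
move=> f f0; apply: (mono_endo_iso lenP).
exact: torsion_free_hom_mono minimal_torsion_free f0 Mq.
Qed.

(** If X is not in T, some map from X to M is nonzero. It cannot vanish on M,
    as it would then factor through the torsion object Z; so it restricts to
    an automorphism of the brick M, which yields a retraction. *)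
Lemma minimal_minimal_extending : minimal_extending T M.
Proof.
have FM := minimal_torsion_free; have Mb := minimal_brick.
case: TT' => _ [_ T'ext _] [subTT' _] _.
split=> // X Z f g fg nsplit TZ.
have T'X : T' X by apply: T'ext fg T'M (subTT' _ TZ).
apply: (cover_left_orthogonal T'M FM M0 T'X) => h.
have [hf0|/Mb.2 [r [rhf _]]] := pselect (h \o f = 0%R).
  have [l <-] := exact_desc fg hf0.
  by rewrite (FM _ TZ l) comp0l.
by case: nsplit; apply: (exact_split fg (r := r \o h)); rewrite -compA.
Qed.

(** Induction on the length: X contains a copy of M, and the quotient C is
    again torsion free. *)
Lemma minimal_Filt : T' `&` rperp T `<=` Filt [set M].
Proof.
have Mb := minimal_brick; have [_ Mext _] := minimal_minimal_extending.
case: (TT') => _ torsT' _ _.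
move=> X [T'X FX]; have [n] := ubnP (len X).
elim: n X T'X FX => // n IH X T'X FX ltXn.
have [X0|X0] := pselect (is_zero X); first exact: (Filt_extension_closed _).1.
have [f f0] : exists f : hom M X, f <> 0%R.
  apply: contrapT => nf; apply: nTM.
  apply: (cover_left_orthogonal T'X FX X0 T'M) => f.
  by apply: contrapT => f0; apply: nf; exists f.
have mf := torsion_free_hom_mono FX f0 Mq.
have [C [q fq]] := mono_exact mf.
apply: (Filt_extension_closed _).2 (fq) _ _.
  by apply: Filt_base => //; apply: brick_indecomposable.
apply: IH; first exact: torsion_quotient torsT' _ _ _ (exact_epi fq) T'X.
  (* The pullback P of X along h is an extension of Y by M. If it splits, then
     h lifts to a map from Y to X, which is zero. Otherwise P is in T, and f
     factors through a map from P to X, which is impossible. *)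
  move=> Y TY h; have [P [u [b [a [ub au qa]]]]] := exact_pullback h fq.
  have [[s bs]|nb] := pselect (split_epi b).
    by rewrite -(compm1 h) -bs compA -qa -compA (FX _ TY (a \o s)) comp0r.
  by case: f0; rewrite -au (FX _ (Mext _ _ _ _ ub nb TY) a) comp0l.
exact: leq_trans (len_quotient lenP fq M0) ltXn.
Qed.

End MinimalObject.

Lemma cover_brick : exists M,
  [/\ brick M, T' M, minimal_extending T M & T' `&` rperp T `<=` Filt [set M]].
Proof.
have [M [T'M nTM Mq]] := cover_minimal_object.
exists M; split=> //; first exact: minimal_brick.
- exact: minimal_minimal_extending.
- exact: minimal_Filt.
Qed.

End Cover.

(** * Torsion subobjects *)

Section TorsionFiltration.
Import GRing.Theory Defs.
Local Open Scope cat_scope.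
Variable A : abelianCat.
Implicit Types X Y Z L M : obj A.
Implicit Types T : set (obj A).

(** The largest subobject of X in T, expressed by maps into X so that no image
    or quotient has to be formed to recognise it. *)
Definition torsion_subobj T X (U : subobj X) :=
  T U /\ forall Y (h : hom Y X), T Y -> exists l, sub_mor U \o l = h.

Lemma torsion_subobj_unique T X (U V : subobj X) :
  torsion_subobj T U -> torsion_subobj T V -> sub_eq U V.
Proof.
move=> [TU Ul] [TV Vl].
have [v vE] := Vl _ (sub_mor U) TU; have [u uE] := Ul _ (sub_mor V) TV.
exists v => //; exists u; split.
  by apply: (@sub_mono _ _ U); rewrite compA uE vE compm1.
by apply: (@sub_mono _ _ V); rewrite compA vE uE compm1.
Qed.

(** The quotient V / U is a quotient of V, so it is in T2. A map h from Y in
    T1 to V / U pulls back to an extension P of Y by U; this P is in T1, so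
    its map to X lands in U, and h vanishes. *)
Lemma torsion_subobj_quotient T1 T2 X (U V : subobj X) :
  torsion_class T1 -> torsion_class T2 -> T1 `<=` T2 ->
  torsion_subobj T1 U -> torsion_subobj T2 V ->
  subquotient_in (T2 `&` rperp T1) U V.
Proof.
move=> [_ ext1 _] [_ _ quot2] T12 [TU Ul] [TV Vl].
have [v vE] := Vl _ (sub_mor U) (T12 _ TU).
have mv : mono v.
  by move=> Z g h vgh; apply: (@sub_mono _ _ U); rewrite -vE -!compA vgh.
have [Q [q vq]] := mono_exact mv.
exists v, Q, q; split=> //; split; first exact: quot2 _ _ _ (exact_epi vq) TV.
move=> Y TY h; have [P [u [b [a [ub au qa]]]]] := exact_pullback h vq.
have [l lE] := Ul _ (sub_mor V \o a) (ext1 _ _ _ _ _ ub TU TY).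
have al : a = v \o l by apply: (@sub_mono _ _ V); rewrite compA vE lE.
apply: (epi0P _).1 (exact_epi ub) _ _ _.
by rewrite -qa al compA (exact_comp0 vq) comp0l.
Qed.

Lemma exact_torsion_subobj T U X V (f : hom U X) (g : hom X V)
    (fg : short_exact f g) :
  T U -> rperp T V -> torsion_subobj T (SubObj (exact_mono fg)).
Proof.
by move=> TU FV; split=> // Y h TY; apply: exact_lift fg (FV _ TY _).
Qed.

End TorsionFiltration.

(** * Maximal green sequences *)

Section GreenSequence.
Import GRing.Theory Defs.
Local Open Scope cat_scope.
Variable A : abelianCat.
Hypothesis lenA : length_category A.
Variables (m : nat) (T : nat -> set (obj A)).
Hypothesis mgsT : maximal_green_sequence m T.
Implicit Types X Y Z L M : obj A.

Lemma green_tors i : i <= m -> torsion_class (T i).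
Proof. by case: mgsT => h _ _ _; apply: h. Qed.

Lemma green_mono i j : i <= j <= m -> T i `<=` T j.
Proof.
elim: j => [|j IH] /andP[]; first by rewrite leqn0 => /eqP-> _ X.
rewrite leq_eqVlt => /predU1P[-> _ X //|le_ij] le_jm.
have [_ cov _ _] := mgsT; have [_ _ [TT _] _] := cov j le_jm.
by apply: subset_trans TT; apply: IH; rewrite -ltnS le_ij ltnW.
Qed.

Lemma green_zero i X : i <= m -> is_zero X -> T i X.
Proof.
move=> le_im X0; apply: (@green_mono 0) => //.
by have [_ _ -> _] := mgsT.
Qed.

Lemma green_extension_closed i : i <= m -> extension_closed (T i).
Proof.
move=> le_im; apply: torsion_extension_closed (green_tors le_im) _ => X.
exact: green_zero.
Qed.

Lemma green_torsion_pair i X : i <= m ->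
  exists U V (f : hom U X) (g : hom X V),
    [/\ short_exact f g, T i U & rperp (T i) V].
Proof.
move=> le_im; have [len lenP] := exists_length lenA.
apply: (torsion_pair lenP (green_tors le_im)) => Z.
exact: green_zero.
Qed.

Definition green_brick i M :=
  [/\ brick M, T i.+1 M, minimal_extending (T i) M &
      T i.+1 `&` rperp (T i) `<=` Filt [set M]].

Lemma green_bricks : exists N : nat -> obj A,
  [/\ N 0 = zob, N m.+1 = zob & forall i, i < m -> green_brick i (N i.+1)].
Proof.
have [len lenP] := exists_length lenA.
have [N NP] : {N : nat -> obj A & forall i, i < m -> green_brick i (N i)}.
  apply: (@choice _ _ (fun i M => i < m -> green_brick i M)) => i.
  have [lt_im|] := boolP (i < m); last by exists zob.
  have [_ cov _ _] := mgsT.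
  have [X|M MP] := cover_brick lenP _ (cov i lt_im); last by exists M.
  exact/green_zero/ltnW.
exists (fun i => if i is j.+1 then if j < m then N j else zob else zob).
by split=> [//||i lt_im]; rewrite ?ltnn ?lt_im //; apply: NP.
Qed.

Variable N : nat -> obj A.
Hypothesis NP : forall i, i < m -> green_brick i (N i.+1).

Lemma torsion_free_brick i j : i < j <= m -> rperp (T i) (N j).
Proof.
case: j => // j /andP[le_ij lt_jm].
have [_ _ [_ _ FN] _] := NP lt_jm.
by move=> Y TY; apply: FN; apply: green_mono TY; rewrite -ltnS le_ij ltnW.
Qed.

Lemma torsion_brick i j : 0 < i <= j -> j <= m -> T j (N i).
Proof.
case: i => // i lt_ij le_jm.
have [_ TN _ _] := NP (leq_trans lt_ij le_jm).
by apply: green_mono TN; apply/andP.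
Qed.

Lemma Filt_brick i : i < m -> Filt [set N i.+1] = T i.+1 `&` rperp (T i).
Proof.
move=> lt_im; have [Nb TN [_ _ FN] sub] := NP lt_im.
apply/seteqP; split=> // X FX; split.
  by apply: (Filt_min (green_extension_closed lt_im)) FX => _ ->.
by apply: (Filt_min (@rperp_extension_closed _ _)) FX => _ ->.
Qed.

(** The torsion pair of T_i exhibits X as an extension of an object of
    Filt(N_(i+1)) by an object of T_i. *)
Lemma green_step_Filt i (S : set (obj A)) X :
  i < m -> T i `<=` Filt S -> S (N i.+1) -> T i.+1 X -> Filt S X.
Proof.
move=> lt_im TS SN TX.
have [U [V [f [g [fg TU FV]]]]] := green_torsion_pair X (ltnW lt_im).
apply: (Filt_extension_closed S).2 (fg) (TS _ TU) _.
have: Filt [set N i.+1] V.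
  rewrite Filt_brick //; split=> //.
  exact: torsion_quotient (green_tors lt_im) _ _ _ (exact_epi fg) TX.
by apply: Filt_mono => _ ->.
Qed.

Lemma green_Filt_step i : i < m -> T i.+1 = Filt (T i `|` [set N i.+1]).
Proof.
move=> lt_im; have [len lenP] := exists_length lenA.
apply/seteqP; split=> X.
  apply: green_step_Filt => //; last by right.
  move=> Y /(torsion_indecomposables lenP (green_tors (ltnW lt_im))).
  by apply: Filt_mono => Z; left.
apply: Filt_min; first exact: green_extension_closed.
move=> Y [|->]; first by apply: green_mono; rewrite leqnSn.
by apply: torsion_brick; rewrite ?leqnn.
Qed.

Lemma green_Filt i : i <= m -> N 0 = zob ->
  T i = Filt [set X | exists2 j, j <= i & X = N j].
Proof.
move=> le_im N0; apply/seteqP; split=> X.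
  elim: i le_im X => [_ X|i IH lt_im X].
    have [_ _ -> _] := mgsT => X0; exact: (Filt_extension_closed _).1.
  apply: green_step_Filt => //; last by exists i.+1.
  move=> Y /(IH (ltnW lt_im)); apply: Filt_mono => Z [j le_ji ->].
  by exists j => //; apply: leqW.
apply: Filt_min; first exact: green_extension_closed.
move=> _ [[|j] le_ji ->]; last exact: torsion_brick.
by rewrite N0; apply: green_zero => //; apply: is_zero_zob.
Qed.

(** Apply the hypothesis to the torsion free quotient V of X for T_i: it
    vanishes. *)
Lemma green_torsion_of_hom_zero i X : i <= m ->
  (forall Y, (forall j, 0 < j <= i -> hom_zero (N j) Y) -> hom_zero X Y) ->
  T i X.
Proof.
move=> le_im XY.
have [U [V [f [g [fg TU FV]]]]] := green_torsion_pair X le_im.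
have g0 : g = 0%R.
  apply: XY => j lt_ji; apply: FV; exact: torsion_brick.
have V0 : is_zero V.
  by apply/is_zeroP/((epi0P _).1 (exact_epi fg)); rewrite g0 comp0r.
have fi := exact_iso_left fg V0.
apply: extension_closed_iso (green_extension_closed le_im) _ TU.
by exists f.
Qed.

(** The left orthogonal of Y is extension closed and contains N_1, ..., N_i,
    hence all of Filt(N_0, ..., N_i). *)
Lemma green_hom_zero i X Y : i <= m -> N 0 = zob -> T i X ->
  (forall j, 0 < j <= i -> hom_zero (N j) Y) -> hom_zero X Y.
Proof.
move=> le_im N0; rewrite (green_Filt le_im N0) => FX NY.
suff: lperp [set Y] X by move/(_ Y); apply.
have Yext := @lperp_extension_closed A [set Y].
apply: (Filt_min Yext) FX => _ [[|j] le_ji ->] _ -> f.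
  by apply: from_zero; rewrite N0; apply: is_zero_zob.
by apply: NY.
Qed.

Lemma green_Gen i : i <= m -> N 0 = zob ->
  T i = Gen_tors (\big[oplus/zob]_(0 <= j < i.+1) N j).
Proof.
move=> le_im N0; apply/seteqP; split=> X.
  move=> TX Y /hom_zero_suml NY.
  apply: green_hom_zero TX _ => // j /andP[_ le_ji].
  by apply: NY; rewrite mem_index_iota.
move=> GX; apply: green_torsion_of_hom_zero => // Y NY.
apply/GX/hom_zero_suml => -[|j]; rewrite mem_index_iota.
  by rewrite N0 => _ f; apply: zob_initial.
by move=> le_ji; apply: NY.
Qed.

(** For the converse, descend from T_m, which contains X: by the orthogonality
    criterion for covers, an object of T_j with no nonzero map to N_j is in
    T_(j-1). *)
Lemma green_lperp i X : i <= m ->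
  T i X <-> forall j, i < j <= m -> hom_zero X (N j).
Proof.
move=> le_im; split=> [TX j ij|XN]; first exact: torsion_free_brick TX.
suff: forall k, k <= m - i -> T (m - k) X.
  by move/(_ _ (leqnn _)); rewrite subKn.
elim=> [_|k IH lt_k]; first by rewrite subn0; have [_ _ _ ->] := mgsT.
have mk : (m - k = (m - k.+1).+1)%N.
  by rewrite subnSK // (leq_trans lt_k) ?leq_subr.
have lt_im' : m - k.+1 < m by rewrite -mk leq_subr.
have [Nb TN [_ _ FN] _] := NP lt_im'.
have [_ cov _ _] := mgsT.
apply: (cover_left_orthogonal _ (cov _ lt_im') TN FN).
- by move=> Y; apply/green_zero/ltnW.
- exact: (brick_indecomposable Nb).1.
- by rewrite -mk; apply/IH/ltnW.
- by apply: XN; rewrite lt_im' andbT ltnS -[leqLHS](subKn le_im) leq_sub2l.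
Qed.

Lemma green_lperp_sum i : i <= m -> N m.+1 = zob ->
  T i = lperp_ob (\big[oplus/zob]_(i.+1 <= j < m.+2) N j).
Proof.
move=> le_im Nm; apply/seteqP; split=> X.
  move=> TX; apply/hom_zero_sumr => j.
  rewrite mem_index_iota ltnS => /andP[lt_ij].
  rewrite leq_eqVlt => /predU1P[->|lt_jm].
    by rewrite Nm => f; apply: zob_terminal.
  by apply: (green_lperp X le_im).1 TX _ _; rewrite lt_ij.
move=> /hom_zero_sumr XN; apply/green_lperp => // j /andP[lt_ij le_jm].
by apply: XN; rewrite mem_index_iota lt_ij ltnS leqW.
Qed.

(** The list is indexed from 0, so its i-th entry is N_(i+1). *)
Lemma green_complete : N 0 = zob ->
  complete_forward_hom_orthogonal [seq N i | i <- iota 1 m].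
Proof.
move=> N0; set s := [seq _ | _ <- _].
have size_s : size s = m by rewrite size_map size_iota.
have nth_s i : i < m -> nth zob s i = N i.+1.
  by move=> lt_im; rewrite (nth_map 0) ?size_iota // nth_iota.
split.
- by move=> i; rewrite size_s => lt_im; rewrite nth_s //; have [] := NP lt_im.
- move=> i j; rewrite size_s => /andP[lt_ij lt_jm].
  rewrite !nth_s ?(ltn_trans lt_ij) //.
  apply: (@torsion_free_brick i.+1); first by rewrite ltnS lt_ij.
  by apply: torsion_brick; rewrite ?leqnn // (ltn_trans lt_ij lt_jm).
- move=> s1 s2 B sE [B0 _] _ fho; apply: B0.
  have sizeE : m = size s1 + size s2 by rewrite -size_s sE size_cat.
  have le_1m : size s1 <= m by rewrite sizeE leq_addr.
  have nth_lt i : i < size s1 -> nth zob (s1 ++ B :: s2) i = N i.+1.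
    move=> lt_i.
    by rewrite nth_cat lt_i -nth_s ?(leq_trans lt_i) // sE nth_cat lt_i.
  have nth_eq : nth zob (s1 ++ B :: s2) (size s1) = B.
    by rewrite nth_cat ltnn subnn.
  have size_ins : size (s1 ++ B :: s2) = m.+1.
    by rewrite size_cat /= addnS -sizeE.
  (* B has no nonzero map to the bricks after it, so it is in T (size s1);
     none of the bricks before it, which generate T (size s1), maps to B. *)
  have TB : T (size s1) B.
    apply/green_lperp => // j /andP[lt_j le_jm].
    have := fho (size s1) j; rewrite size_ins lt_j ltnS le_jm => /(_ isT).
    rewrite nth_eq nth_cat ltnNge (ltnW lt_j) /=.
    case: j lt_j le_jm => // j lt_j le_jm; rewrite subSn //=.
    by rewrite -nth_s // sE nth_cat ltnNge -ltnS lt_j.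
  apply: (green_hom_zero le_1m N0 TB) => -[//|j] /andP[_ lt_j].
  have := fho j (size s1); rewrite size_ins lt_j ltnS le_1m => /(_ isT).
  by rewrite nth_eq nth_lt.
- apply/seteqP; split=> // X _ Y XY.
  have: T m X by have [_ _ _ ->] := mgsT.
  move=> /green_hom_zero; apply=> // j lt_jm.
  move: XY; rewrite /rperp_ob /s /= big_map => /hom_zero_suml; apply.
  by rewrite mem_iota add1n ltnS.
Qed.

Lemma green_filtration_torsion X (F : nat -> subobj X) :
  (forall i, i <= m -> torsion_subobj (T i) (F i)) ->
  filtration (fun i => Filt [set N i.+1]) m F.
Proof.
move=> FT; split.
- by have [+ _] := FT 0 isT; have [_ _ -> _] := mgsT.
- have [_ Fl] := FT m (leqnn m).
  have [|l lE] := Fl X (idm X); first by have [_ _ _ ->] := mgsT.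
  apply: mono_epi_iso (@sub_mono _ _ (F m)) _ => Z g h gh.
  by rewrite -(compm1 g) -(compm1 h) -lE !compA gh.
- move=> i lt_im; rewrite Filt_brick //.
  apply: torsion_subobj_quotient; try exact: FT; try exact: green_tors.
  - exact/green_tors/ltnW.
  - by apply: green_mono; rewrite leqnSn.
  - exact/FT/ltnW.
Qed.

(** The i-th term is in T_i as an iterated extension. Maps to X from an object
    of T_i are lifted to it by descending from the m-th term: each quotient on
    the way, in Filt(N_(j+1)) for some j >= i, is right orthogonal to T_j and
    so to T_i. *)
Lemma green_filtrationP X (F : nat -> subobj X) :
  filtration (fun i => Filt [set N i.+1]) m F ->
  forall i, i <= m -> torsion_subobj (T i) (F i).
Proof.
move=> [F0 Fm FS] i le_im; split.
  elim: i le_im => [le_0m|i IH lt_im]; first exact: green_zero.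
  have [v [Q [q [_ vq]]]] := FS i lt_im; rewrite Filt_brick // => -[TQ _].
  apply: (green_extension_closed lt_im).2 (vq) _ TQ.
  by apply: green_mono (IH (ltnW lt_im)); rewrite leqnSn.
suff lift k Y (h : hom Y X) : k <= m -> T (m - k) Y ->
    exists l, sub_mor (F (m - k)) \o l = h.
  by move=> Y h; rewrite -(subKn le_im); apply/lift/leq_subr.
elim: k Y h => [|k IH] Y h le_km TY.
  rewrite subn0; have [g [_ Fg]] := Fm.
  by exists (g \o h); rewrite compA Fg comp1m.
have mk : (m - k = (m - k.+1).+1)%N by rewrite subnSK.
have lt_im' : m - k.+1 < m by rewrite -mk leq_subr.
have [|l lE] := IH Y h (ltnW le_km).
  by apply: green_mono TY; rewrite leq_subr leq_sub2l.
have [v [Q [q [vE vq]]]] := FS _ lt_im'; rewrite Filt_brick // => -[_ FQ].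
rewrite mk in l lE.
have [l' l'E] := exact_lift vq (FQ _ TY (q \o l)).
by exists l'; rewrite -vE -compA l'E.
Qed.

Lemma green_unique_filtration X : exists F : nat -> subobj X,
  filtration (fun i => Filt [set N i.+1]) m F /\
  forall F' : nat -> subobj X,
    filtration (fun i => Filt [set N i.+1]) m F' ->
    forall i, i <= m -> sub_eq (F i) (F' i).
Proof.
pose P i (U : subobj X) := i <= m -> torsion_subobj (T i) U.
have [F FT] : {F : nat -> subobj X & forall i, P i (F i)}.
  apply: (@choice _ _ P) => i; rewrite /P.
  have [le_im|] := boolP (i <= m); last by exists (SubObj (@mono_id _ X)).
  have [U [V [f [g [fg TU FV]]]]] := green_torsion_pair X le_im.
  by exists (SubObj (exact_mono fg)) => _; apply: exact_torsion_subobj.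
exists F; split=> [|F' /green_filtrationP F'T i le_im].
  exact: green_filtration_torsion.
exact: torsion_subobj_unique (FT _ le_im) (F'T _ le_im).
Qed.

End GreenSequence.

Theorem theorem2p13 (A : abelianCat) (lenA : length_category A)
    (m : nat) (T : nat -> set (obj A)) (mgsT : maximal_green_sequence m T) :
  exists N : nat -> obj A,
    [/\ N 0 = zob, N m.+1 = zob & forall i, 1 <= i <= m -> brick (N i)] /\
    [/\ (* (i) *)
        forall i, 1 <= i <= m ->
          minimal_extending (T i.-1) (N i) /\
          T i = Filt (T i.-1 `|` [set N i]),
        (* (ii) *)
        forall i, i <= m ->
          [/\ T i = Filt [set X | exists2 j, j <= i & X = N j],
              T i = Gen_tors (\big[oplus/zob]_(0 <= j < i.+1) N j) &
              T i = lperp_ob (\big[oplus/zob]_(i.+1 <= j < m.+2) N j)],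
        (* (iii) *)
        complete_forward_hom_orthogonal [seq N i | i <- iota 1 m],
        (* (iv) *)
        forall i, 1 <= i <= m -> Filt [set N i] = T i `&` rperp (T i.-1) &
        (* (v) *)
        forall X : obj A, exists F : nat -> subobj X,
          filtration (fun i => Filt [set N i.+1]) m F /\
          forall F' : nat -> subobj X,
            filtration (fun i => Filt [set N i.+1]) m F' ->
            forall i, i <= m -> sub_eq (F i) (F' i)].
Proof.
have [N [N0 Nm NP]] := green_bricks lenA mgsT.
exists N; split.
  by split=> // -[//|i] lt_im; have [] := NP _ lt_im.
split.
- move=> [//|i] lt_im; split; first by have [] := NP _ lt_im.
  exact (green_Filt_step lenA mgsT NP lt_im).
- move=> i le_im; split.
  + exact (green_Filt lenA mgsT NP le_im N0).
  + exact (green_Gen lenA mgsT NP le_im N0).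
  + exact (green_lperp_sum mgsT NP le_im Nm).
- exact (green_complete lenA mgsT NP N0).
- move=> [//|i] lt_im; exact (Filt_brick mgsT NP lt_im).
- exact (green_unique_filtration lenA mgsT NP).
Qed.
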